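(* Let $G$ be a graph on $V$ and $G^*$ a graph on $V^*$, and suppose there is a non-empty $S\subseteq V$ such that $W^S_G$ has rank $\geq|V|-1$. Then $G$ is isomorphic to $G^*$ if and only if $(G,S)\sim(G^*,S^* )$ for some vertex set $S^*\subseteq V^*$. Furthermore, if $(G,S)\sim(G^*,S^* )$, then every bijection $\varphi:V\to V^*$ such that for all $v\in V$ the row of $W^{S^*}_{G^*}$ indexed by $\varphi(v)$ equals the row of $W^S_G$ indexed by $v$ is an isomorphism $G\to G^*$; there is exactly one such bijection if the rows of $W^S_G$ are pairwise distinct, and exactly two otherwise. (So the isomorphism is determined from the lex forms of $W^S_G$ and $W^{S^*}_{G^*}$, uniquely unless $W^S_G$ has a repeated row, in which case there are two.)
   Context: Graphs are finite, simple, undirected. For a graph $G$ on $V=\{v_1,\dots,v_n\}$ with adjacency matrix $A$ and $S\subseteq V$ with characteristic vector ${\rm e}\in\{0,1\}^n$, the walk matrix is $W^S_G=[{\rm e},A{\rm e},\dots,A^{n-1}{\rm e}]$, with rows indexed by the vertices. For graphs $G$ on $V$ and $G^*$ on $V^*$ and $S\subseteq V$, $S^*\subseteq V^*$, we write $(G,S)\sim(G^*,S^* )$ (walk equivalence) if $|V|=|V^*|$ and there is a bijection $\varphi:V\to V^*$ such that for every $v\in V$ the row of $W^{S^*}_{G^*}$ indexed by $\varphi(v)$ equals the row of $W^S_G$ indexed by $v$; equivalently $W^{S^*}_{G^*}=PW^S_G$ for a permutation matrix $P$, equivalently the two walk matrices have equal lexicographically row-sorted forms. *)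

(* Defs.v *)
From HB Require Import structures.
From mathcomp Require Import all_boot all_order all_algebra.

Set Implicit Arguments.
Unset Strict Implicit.
Unset Printing Implicit Defensive.

Import GRing.Theory.
Local Open Scope ring_scope.

Record sgraph (V : finType) := SGraph {
  edge :> rel V;
  edge_sym : symmetric edge;
  edge_irrefl : irreflexive edge }.

Definition is_iso (V V' : finType) (G : sgraph V) (G' : sgraph V')
    (phi : V -> V') : Prop :=
  bijective phi /\ forall u v, G' (phi u) (phi v) = G u v.

Definition isomorphic (V V' : finType) (G : sgraph V) (G' : sgraph V') : Prop :=
  exists phi : V -> V', is_iso G G' phi.

(* The vertex in row i is [enum_val i]; the row of v is [enum_rank v]. The
   entries are 0/1 integers, taken in [rat] so that the rank is available. *)
Definition adj_mx (V : finType) (G : sgraph V) : 'M[rat]_#|V| :=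
  \matrix_(i, j) (G (enum_val i) (enum_val j))%:R.

Definition char_vec (V : finType) (S : {set V}) : 'cV[rat]_#|V| :=
  \col_i (enum_val i \in S)%:R.

Definition walk_mx (V : finType) (G : sgraph V) (S : {set V}) : 'M[rat]_#|V| :=
  \matrix_(i, j) (adj_mx G ^+ j *m char_vec S) i 0.

(* A sequence rather than a row vector, so that rows of walk matrices on
   different vertex types can be compared; equality includes equal length. *)
Definition walk_row (V : finType) (G : sgraph V) (S : {set V}) (v : V)
    : seq rat :=
  [seq walk_mx G S (enum_rank v) j | j : 'I_#|V|].

Definition row_bij (V V' : finType) (G : sgraph V) (S : {set V})
    (G' : sgraph V') (S' : {set V'}) (phi : V -> V') : Prop :=
  bijective phi /\ forall v, walk_row G' S' (phi v) = walk_row G S v.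

Definition walk_equiv (V V' : finType) (G : sgraph V) (S : {set V})
    (G' : sgraph V') (S' : {set V'}) : Prop :=
  #|V| = #|V'| /\ exists phi : V -> V', row_bij G S G' S' phi.

(* Main.v *)
(* A row-preserving bijection phi turns the pullback of A' along phi into a
   symmetric matrix B with B^j e = A^j e for all j < n, so D = B - A kills
   e, A e, ..., A^(n-2) e. These are independent: in a Krylov sequence, once a
   vector depends on its predecessors, so do all the later ones, and the walk
   matrix would have rank < n - 1. Hence D has rank at most 1; as D is symmetric
   with zero diagonal, D = 0.

   Two equal rows i, j of the walk matrix put e_i - e_j in its left kernel, which
   has dimension at most 1. So at most one pair of rows coincides, and two
   row-preserving bijections differ at most by that transposition. *)

Require Import Defs.
From HB Require Import structures.
From mathcomp Require Import all_boot all_order all_algebra.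
From mathcomp Require Import fingroup perm.

Set Implicit Arguments.
Unset Strict Implicit.
Unset Printing Implicit Defensive.

Import GRing.Theory.

Local Open Scope ring_scope.

Lemma trmxX (R : comPzRingType) n (A : 'M[R]_n) k : (A ^+ k)^T = A^T ^+ k.
Proof.
elim: k => [|k IHk]; first exact: trmx1.
by rewrite exprS exprSr -!mulmxE trmx_mul IHk.
Qed.

(** * Krylov spaces of a row vector *)

Section Krylov.
Variables (F : fieldType) (n : nat) (A : 'M[F]_n) (u : 'rV[F]_n).

(** [<<_>>] turns each row vector into a square matrix with the same row space, so that the
    subspaces can be summed. *)
Definition krylov (k : nat) : 'M[F]_n := (\sum_(j < k) <<u *m A ^+ j>>)%MS.

Lemma krylov_recr k : (krylov k.+1 :=: krylov k + u *m A ^+ k)%MS.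
Proof.
by rewrite /krylov big_ord_recr /=; apply: adds_eqmx; [|exact: genmxE].
Qed.

Lemma sub_krylov k j : (j < k)%N -> (u *m A ^+ j <= krylov k)%MS.
Proof.
by move=> jk; apply: (sumsmx_sup (Ordinal jk)) => //=; rewrite genmxE.
Qed.

Lemma krylov_sub m (M : 'M[F]_(m, n)) k :
  (forall j, (j < k)%N -> (u *m A ^+ j <= M)%MS) -> (krylov k <= M)%MS.
Proof. by move=> kM; apply/sumsmx_subP => j _; rewrite genmxE kM. Qed.

Lemma krylov_stable_powers k j :
  (0 < k)%N -> stablemx (krylov k) A -> (u *m A ^+ j <= krylov k)%MS.
Proof.
move=> k0 kA; elim: j => [|j IHj]; first exact: sub_krylov.
rewrite exprSr -mulmxE mulmxA; exact: submx_trans (submxMr A IHj) kA.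
Qed.

(** While each new vector lies outside the span of its predecessors, the rank grows by one. The
    first vector inside that span makes the space stable under [A], and it stops growing. The clause
    [0 < k] guarantees that the stable space contains [u]. *)
Lemma krylov_rankVstable k :
  (k <= \rank (krylov k))%N \/ (0 < k)%N /\ stablemx (krylov k) A.
Proof.
elim: k => [|k [rk|[k0 kA]]]; first by left.
- have [uk|uk] := boolP (u *m A ^+ k <= krylov k)%MS; last first.
    left; rewrite krylov_recr.
    apply: (leq_ltn_trans rk); apply: rank_ltmx.
    rewrite ltmxE addsmxSl /=; apply: contra uk; apply: submx_trans.
    exact: addsmxSr.
  right; split=> //.
  have kk : (krylov k.+1 <= krylov k)%MS.
    by rewrite krylov_recr addsmx_sub submx_refl.
  apply: (submx_trans (submxMr A kk)).
  rewrite [X in X *m _]/krylov sumsmxMr; apply/sumsmx_subP => j _.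
  rewrite (eqmxMr A (genmxE _)) -mulmxA mulmxE -exprSr.
  by apply: sub_krylov; rewrite ltnS.
- right; split=> //.
  have kk : (krylov k.+1 <= krylov k)%MS.
    by rewrite krylov_recr addsmx_sub submx_refl krylov_stable_powers.
  apply: (submx_trans (submxMr A kk)); apply: (submx_trans kA).
  by rewrite krylov_recr addsmxSl.
Qed.

(** Otherwise [krylov k] is stable, hence contains every [u *m A ^+ j], and so all of [krylov m]. *)
Lemma krylov_rank_ge k m :
  (k <= \rank (krylov m))%N -> (k <= \rank (krylov k))%N.
Proof.
move=> km; case: (krylov_rankVstable k) => [//|[k0 kA]].
apply: leq_trans km _; apply: mxrankS; apply: krylov_sub => j _.
exact: krylov_stable_powers.
Qed.

End Krylov.

(** * Matrices of rank at most one *)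

Lemma rank_le1_sub (F : fieldType) m n (M : 'M[F]_(m, n)) (x y : 'rV_n) :
  (\rank M <= 1)%N -> (x <= M)%MS -> x != 0 -> (y <= M)%MS ->
  exists a, y = a *: x.
Proof.
move=> M1 xM x0 yM; apply/sub_rVP; apply: submx_trans yM _.
(* Since [x] lies in the row space of [M], the reverse inclusion is a comparison of ranks. *)
rewrite -(geq_leqif (mxrank_leqif_sup xM)).
by apply: leq_trans M1 _; rewrite lt0n mxrank_eq0.
Qed.

(** If [D i j] is nonzero, row [i] is nonzero and row [j] is a multiple of it. In column [i] this
    multiple is 0 because [D i i = 0], against symmetry. *)
Lemma sym_hollow_rank_le1 (F : fieldType) n (D : 'M[F]_n) :
  D^T = D -> (forall i, D i i = 0) -> (\rank D <= 1)%N -> D = 0.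
Proof.
move=> symD D0 D1; apply/matrixP => i j; rewrite mxE.
apply/eqP/negPn/negP => Dij.
have Di0 : row i D != 0.
  by apply: contra Dij => /eqP/rowP/(_ j); rewrite !mxE => ->.
have [a /rowP/(_ i)] := rank_le1_sub D1 (row_sub i D) Di0 (row_sub j D).
by rewrite !mxE D0 mulr0 -symD mxE => /eqP; rewrite (negPf Dij).
Qed.

(** * Walk counts and the walk matrix *)

Section Walks.
Variables (V : finType) (G : sgraph V) (S : {set V}).

(** The number of walks of length [j] from [v] that end in [S]. Indexing by vertices instead of
    ordinals lets the counts be transported along a bijection. *)
Fixpoint walks (j : nat) (v : V) : rat :=
  if j is k.+1 then \sum_u (G v u)%:R * walks k u else (v \in S)%:R.

Lemma adj_mxXE j i : (adj_mx G ^+ j *m char_vec S) i 0 = walks j (enum_val i).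
Proof.
elim: j i => [|j IHj] i; first by rewrite mul1mx mxE.
rewrite exprS -mulmxE -mulmxA mxE /= [RHS](reindex (enum_val : 'I_#|V| -> V)) /=;
  last exact/onW_bij/enum_val_bij.
by apply: eq_bigr => k _; rewrite IHj mxE.
Qed.

Lemma walk_rowE v : walk_row G S v = [seq walks j v | j <- iota 0 #|V|].
Proof.
rewrite /walk_row -val_enum_ord -map_comp; apply: eq_map => j /=.
by rewrite mxE adj_mxXE enum_rankK.
Qed.

Lemma adj_mx_sym : (adj_mx G)^T = adj_mx G.
Proof. by apply/matrixP => i j; rewrite !mxE edge_sym. Qed.

(** As [A] is symmetric, the columns [A^j e] transpose to the rows [e^T A^j]. The rank of the walk
    matrix is thus bounded by that of the Krylov space. *)
Lemma trmx_walk_krylov :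
  ((walk_mx G S)^T <= krylov (adj_mx G) (char_vec S)^T #|V|)%MS.
Proof.
apply/row_subP => j.
suff -> : row j (walk_mx G S)^T = (char_vec S)^T *m adj_mx G ^+ j.
  exact: sub_krylov.
by apply/rowP => i; rewrite -adj_mx_sym -trmxX -trmx_mul !mxE.
Qed.

End Walks.

Lemma eq_walk_row (V V' : finType) (G : sgraph V) (S : {set V})
    (G' : sgraph V') (S' : {set V'}) v v' : #|V| = #|V'| ->
  walk_row G' S' v' = walk_row G S v <->
  forall j, (j < #|V|)%N -> walks G' S' j v' = walks G S j v.
Proof.
move=> cV; rewrite !walk_rowE -cV; split=> [/eq_in_map vv j jn|vv].
  by apply: vv; rewrite mem_iota.
by apply/eq_in_map => j; rewrite mem_iota; apply: vv.
Qed.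

Lemma iso_walks (V V' : finType) (G : sgraph V) (S : {set V})
    (G' : sgraph V') (phi : V -> V') j v :
  is_iso G G' phi -> walks G' (phi @: S) j (phi v) = walks G S j v.
Proof.
case=> bphi Gphi; elim: j v => [|j IHj] v /=.
  by rewrite mem_imset //; apply: bij_inj.
rewrite (reindex phi) /=; last exact: onW_bij.
by apply: eq_bigr => u _; rewrite Gphi IHj.
Qed.

(** * Consequences of rank at least [#|V| - 1] *)

Section Rigidity.
Variables (V V' : finType) (G : sgraph V) (G' : sgraph V').
Variables (S : {set V}) (S_neq0 : S != set0).
Hypothesis rank_ge : (#|V| - 1 <= \rank (walk_mx G S))%N.

Lemma row_bij_iso (S' : {set V'}) (phi : V -> V') :
  row_bij G S G' S' phi -> is_iso G G' phi.
Proof.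
case=> bphi rphi; split=> //.
have walksE j v : (j < #|V|)%N -> walks G' S' j (phi v) = walks G S j v.
  by move: j; apply/(eq_walk_row _ _ _ _ _ _ (bij_eq_card bphi)).
pose D : 'M[rat]_#|V| := \matrix_(i, j)
  ((G' (phi (enum_val i)) (phi (enum_val j)))%:R
   - (G (enum_val i) (enum_val j))%:R).
have symD : D^T = D.
  by apply/matrixP => i j; rewrite !mxE edge_sym (edge_sym G).
(* The entries of [D] are differences of 0/1 values, so their vanishing gives back equality of the
   booleans. *)
suff D0 : D = 0.
  move=> u v; move/matrixP/(_ (enum_rank u) (enum_rank v)): D0.
  rewrite !mxE !enum_rankK => /eqP; rewrite subr_eq0.
  by case: (G' _ _) (G u v) => [] [].
apply: sym_hollow_rank_le1 => // [i|]; first by rewrite mxE !edge_irrefl subrr.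
have V_gt0 : (0 < #|V|)%N.
  by case/set0Pn: S_neq0 => v _; apply/card_gt0P; exists v.
have rK : (#|V| - 1 <= \rank (krylov (adj_mx G) (char_vec S)^T (#|V| - 1)))%N.
  apply: (@krylov_rank_ge _ _ _ _ _ #|V|); apply: leq_trans rank_ge _.
  by rewrite -mxrank_tr mxrankS ?trmx_walk_krylov.
(* By rank-nullity, a kernel of dimension at least [#|V| - 1] leaves rank at most 1 for [D]. *)
suff KD : (krylov (adj_mx G) (char_vec S)^T (#|V| - 1) <= kermx D)%MS.
  have := leq_trans rK (mxrankS KD); rewrite mxrank_ker.
  by rewrite leq_sub2lE ?rank_leq_row.
apply: krylov_sub => j jn; apply/sub_kermxP; apply: trmx_inj.
rewrite -adj_mx_sym -trmxX -trmx_mul [LHS]trmx_mul.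
rewrite trmxK symD trmx0.
apply/colP => i; rewrite !mxE.
(* With [B] the pullback of [G'], [D A^j e = B^(j+1) e - A^(j+1) e]. This uses equality of the walk
   counts at [j] and at [j.+1], which is why [j] stops at [#|V| - 2]. *)
have j1n : (j.+1 < #|V|)%N by rewrite ltn_subRL in jn.
have := walksE _ (enum_val i) j1n => /=.
rewrite (reindex phi) /=; last exact: onW_bij.
move/eqP; rewrite -subr_eq0 -sumrB => /eqP sum0.
rewrite -[RHS]sum0 [RHS](reindex (enum_val : 'I_#|V| -> V)) /=;
  last exact/onW_bij/enum_val_bij.
apply: eq_bigr => k _; rewrite adj_mxXE mxE mulrBl walksE //.
exact: ltnW.
Qed.

Lemma repeated_row_unique x y z t :
  x != y -> walk_row G S x = walk_row G S y ->
  z != t -> walk_row G S z = walk_row G S t -> (z == x) || (z == y).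
Proof.
move=> xy Wxy zt Wzt.
pose d a b : 'rV[rat]_#|V| :=
  delta_mx 0 (enum_rank a) - delta_mx 0 (enum_rank b).
have dE a b c : d a b 0 (enum_rank c) = (c == a)%:R - (c == b)%:R.
  by rewrite !mxE !eqxx /= !(inj_eq enum_rank_inj).
have dker a b : walk_row G S a = walk_row G S b ->
    (d a b <= kermx (walk_mx G S))%MS.
  move=> Wab; apply/sub_kermxP; rewrite mulmxBl -!rowE; apply/eqP.
  rewrite subr_eq0; apply/eqP/rowP => j.
  do 2!rewrite [LHS]mxE [RHS]mxE; rewrite !adj_mxXE !enum_rankK.
  by move/(eq_walk_row _ _ _ _ _ _ erefl): Wab; apply.
have ker1 : (\rank (kermx (walk_mx G S)) <= 1)%N.
  by rewrite mxrank_ker leq_subLR addnC -leq_subLR.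
have dneq0 : d x y != 0.
  apply/eqP => /rowP/(_ (enum_rank x)); rewrite dE eqxx (negPf xy) mxE subr0.
  by apply/eqP; rewrite oner_eq0.
(* [d z t] is a multiple of [d x y]. Its coordinate at [z] is 1, while that of [d x y] is 0 unless
   [z] is [x] or [y]. *)
have [a /rowP/(_ (enum_rank z))] :=
  rank_le1_sub ker1 (dker _ _ Wxy) dneq0 (dker _ _ Wzt).
rewrite [RHS]mxE !dE eqxx (negPf zt).
case: (z == x) => //; case: (z == y) => //=.
by rewrite !subr0 mulr0 => /eqP; rewrite oner_eq0.
Qed.

End Rigidity.

(* Equivalence with isomorphism, and the count of bijections *)
Local Close Scope ring_scope.

Theorem theorem6p3 (V V' : finType) (G : sgraph V) (G' : sgraph V')
    (S : {set V}) (S_neq0 : S != set0)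
    (rank_ge : #|V| - 1 <= \rank (walk_mx G S)) :
  (isomorphic G G' <-> exists S' : {set V'}, walk_equiv G S G' S') /\
  (forall S' : {set V'}, walk_equiv G S G' S' ->
     (forall phi : V -> V', row_bij G S G' S' phi -> is_iso G G' phi) /\
     (injective (walk_row G S) ->
        exists! phi : {ffun V -> V'}, row_bij G S G' S' phi) /\
     (~ injective (walk_row G S) ->
        exists phi1 phi2 : {ffun V -> V'}, phi1 <> phi2 /\
          forall phi : {ffun V -> V'},
            row_bij G S G' S' phi <-> phi = phi1 \/ phi = phi2)).
Proof.
have isoP S' phi : row_bij G S G' S' phi -> is_iso G G' phi.
  exact: (row_bij_iso S_neq0 rank_ge).
split.
  split=> [[phi iphi]|[S' [_ [phi rphi]]]]; last by exists phi; apply: isoP rphi.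
  have cV := bij_eq_card iphi.1.
  exists (phi @: S); split=> //; exists phi; split=> [|v]; first by case: iphi.
  by apply/(eq_walk_row _ _ _ _ _ _ cV) => j _; apply: iso_walks.
move=> S' [_ [phi [bphi rphi]]]; split; first exact: isoP.
have [g phiK gK] := bphi.
(* Any [psi] is compared with the fixed [phi] through [g \o psi], a permutation of [V] that
   preserves the rows of the walk matrix of [G]. *)
have rg psi v : row_bij G S G' S' psi ->
    walk_row G S (g (psi v)) = walk_row G S v.
  by case=> _ rpsi; rewrite -rphi gK.
have rf : row_bij G S G' S' [ffun v => phi v].
  split=> [|v]; last by rewrite ffunE.
  by apply: eq_bij bphi _ _ => v; rewrite ffunE.
split=> [injW|ninjW].
  exists [ffun v => phi v]; split=> // psi rpsi; apply/ffunP => v.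
  by rewrite ffunE -[in LHS](injW _ _ (rg _ v rpsi)) gK.
have [x [y [xy Wxy]]] : exists x y, x != y /\ walk_row G S x = walk_row G S y.
  (* A finite search over pairs extracts a repeated row from the failure of injectivity. *)
  case: (pickP [pred p : V * V |
    (p.1 != p.2) && (walk_row G S p.1 == walk_row G S p.2)]).
    by move=> [x y] /= /andP[xy /eqP Wxy]; exists x, y.
  move=> none; case: ninjW => x y Wxy; apply/eqP.
  by have := none (x, y); rewrite /= Wxy eqxx andbT => /negbFE.
have pairP z t : z != t -> walk_row G S z = walk_row G S t ->
    (z == x) || (z == y).
  exact: repeated_row_unique rank_ge _ _ _ _ xy Wxy.
exists [ffun v => phi v], [ffun v => phi (tperm x y v)]; split.
  move/ffunP/(_ x); rewrite !ffunE tpermL => /(bij_inj bphi)/eqP.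
  by rewrite (negPf xy).
move=> psi; split=> [rpsi|[]->]; last 2 first.
- exact: rf.
- split=> [|v].
    apply: eq_bij (bij_comp bphi (injF_bij (@perm_inj _ (tperm x y)))) _ _ => v.
    by rewrite ffunE.
  by rewrite ffunE rphi; case: tpermP => // ->.
have injgpsi : injective (fun v => g (psi v)).
  apply: inj_comp; first exact: can_inj gK.
  exact: bij_inj rpsi.1.
(* [g \o psi] fixes all vertices other than [x] and [y] and maps this pair to itself. The image of
   [x] then decides between the identity and the transposition. *)
have fixg z : z != x -> z != y -> g (psi z) = z.
  move=> zx zy; apply/eqP/negPn/negP; rewrite eq_sym => gz.
  by have := pairP _ _ gz (esym (rg _ z rpsi)); rewrite (negPf zx) (negPf zy).
have gxy z : (z == x) || (z == y) -> (g (psi z) == x) || (g (psi z) == y).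
  move=> zxy; case: (eqVneq (g (psi z)) z) => [-> //|gz].
  exact: pairP gz (rg _ z rpsi).
case/orP: (gxy x (predU1l _ (erefl x))) => /eqP gx.
- left.
  have gy : g (psi y) = y.
    have := gxy y; rewrite eqxx orbT => /(_ isT)/orP[/eqP gyx|/eqP//].
    by move: xy; rewrite (injgpsi _ _ (etrans gx (esym gyx))) eqxx.
  apply/ffunP => v; rewrite ffunE -[LHS]gK; congr phi.
  case: (eqVneq v x) => [->//|vx]; case: (eqVneq v y) => [->//|vy]; exact: fixg.
- right.
  have gy : g (psi y) = x.
    have := gxy y; rewrite eqxx orbT => /(_ isT)/orP[/eqP//|/eqP gyy].
    by move: xy; rewrite (injgpsi _ _ (etrans gx (esym gyy))) eqxx.
  apply/ffunP => v; rewrite ffunE -[LHS]gK; congr phi.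
  case: tpermP => [->|->|/eqP vx /eqP vy] //; exact: fixg.
Qed.
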